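(* For any linear order $L$ with $|G(L)|<2^{\aleph_0}$ we have $\mathbb{Q}\not\leq_s L$. Hence $\mathbb{Q}$ witnesses the fact that $\mathbb{R}$, $\mathbb{R}\setminus\mathbb{Q}$, $\mathbb{Z}^{\mathbb{N}}$ ordered lexicographically, and, for every countable ordinal $\alpha\geq\omega$, $2^\alpha$ ordered lexicographically are not strongly surjective; that is, for each such order $M$, $\mathbb{Q}$ embeds into $M$ but there is no epimorphism from $M$ onto $\mathbb{Q}$.
   Context: All linear orders are assumed non-empty. $L\leq_s M$ means there is an epimorphism (order preserving surjection) from $M$ onto $L$. An embedding is an order preserving injection. A linear order $M$ is strongly surjective if for every linear order $L$ that embeds into $M$ there is an epimorphism from $M$ onto $L$. A gap of a linear order $K$ is a non-empty initial segment $A\subseteq K$ with no maximum such that $K\setminus A$ is non-empty and has no minimum. $G(K)$ is the set of gaps of $K$. $\mathbb{Z}^{\mathbb{N}}$ is the set of all functions $\mathbb{N}\to\mathbb{Z}$, and $2^\alpha$ the set of all functions $\alpha\to\{0,1\}$; in the lexicographic order two distinct functions are compared at the least argument where they differ. *)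

(* Defs.v *)
From HB Require Import structures.
From mathcomp Require Import all_boot all_order all_algebra.
From mathcomp Require Import boolp classical_sets functions cardinality wochoice.
From mathcomp Require Import reals.

Set Implicit Arguments.
Unset Strict Implicit.
Unset Printing Implicit Defensive.

Import Order.TTheory.

Local Open Scope order_scope.
Local Open Scope card_scope.
Local Open Scope classical_set_scope.

Section Epimorphisms.
Context {d d' : Order.disp_t}.

Definition epimorphism (M : orderType d) (L : orderType d') (f : M -> L) :=
  {homo f : x y / x <= y} /\ set_surj [set: M] [set: L] f.

Definition embedding (L : orderType d') (M : orderType d) (f : L -> M) :=
  {homo f : x y / x <= y} /\ injective f.

(* L <=_s M *)
Definition le_s (L : orderType d') (M : orderType d) :=
  exists f : M -> L, epimorphism f.

Definition embeds (L : orderType d') (M : orderType d) :=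
  exists f : L -> M, embedding f.

Definition witnesses_not_strongly_surjective
    (L : orderType d') (M : orderType d) :=
  embeds L M /\ ~ le_s L M.

End Epimorphisms.

(* An orderType may be empty, whereas linear orders are assumed non-empty. *)
Definition strongly_surjective d (M : orderType d) :=
  forall (d' : Order.disp_t) (L : orderType d'),
    [set: L] !=set0 -> embeds L M -> le_s L M.

Section Gaps.
Context {d : Order.disp_t} (K : orderType d).

Definition initial_segment (A : set K) := forall x y, x <= y -> A y -> A x.

(* [A `&` ubound A] is the set of maxima of A, [A `&` lbound A] that of its
   minima. *)
Definition is_gap (A : set K) :=
  [/\ initial_segment A, A !=set0, A `&` ubound A = set0,
      ~` A !=set0 & ~` A `&` lbound (~` A) = set0].

Definition gaps : set (set K) := [set A | is_gap A].

End Gaps.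

Arguments gaps {d} K.

Definition card_lt {T U : Type} (A : set T) (B : set U) :=
  A #<= B /\ ~ (B #<= A).

(* Well-ordered types; an ordinal is represented by any well-ordered type of
   that order type. *)
HB.mixin Record isWellOrder (d : Order.disp_t) T of Order.Total d T := {
  le_well_order : well_order (<=%O : rel T)
}.

#[short(type="wellOrderType")]
HB.structure Definition WellOrder (d : Order.disp_t) :=
  { T of isWellOrder d T & Order.Total d T }.

Lemma nat_well_order : well_order (<=%O : rel nat).
Proof.
apply: antisymmetric_well_order; first exact: le_anti.
move=> A exA; case: (ex_minnP exA) => m Am minm.
by exists m; split=> // k Ak; rewrite leEnat; exact: minm.
Qed.

HB.instance Definition _ := isWellOrder.Build _ nat nat_well_order.

(* Comparison of ordinals: A is isomorphic to an initial segment of B. *)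
Definition ord_le {d d' : Order.disp_t}
    (A : wellOrderType d) (B : wellOrderType d') :=
  exists f : A -> B, embedding f /\ initial_segment (range f).

(* All functions I -> T, with the lexicographic order. *)
Definition lexfun {d d' : Order.disp_t}
  (I : wellOrderType d) (T : orderType d') : Type := I -> T.

Section Lexicographic.
Context {d d' : Order.disp_t} (I : wellOrderType d) (T : orderType d').
Implicit Types f g h : lexfun I T.

HB.instance Definition _ := Choice.copy (lexfun I T) (I -> T).

(* f and g differ, and f is smaller at the least argument where they differ *)
Definition lexfun_lt f g : bool :=
  `[< exists i, (forall j, j < i -> f j = g j) /\ f i < g i >].

Definition lexfun_le f g : bool := (f == g) || lexfun_lt f g.

Fact lexfun_lt_irr : irreflexive lexfun_lt.
Proof. by move=> f; apply/asboolP => -[i [_]]; rewrite ltxx. Qed.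

Fact lexfun_lt_trans : transitive lexfun_lt.
Proof.
move=> g f h /asboolP[i [fgE fg]] /asboolP[k [ghE gh]]; apply/asboolP.
have [ik|ki|ik] := ltgtP i k.
- exists i; split=> [j ji|]; first by rewrite fgE// ghE// (lt_trans ji).
  by rewrite -ghE.
- exists k; split=> [j jk|]; first by rewrite fgE ?ghE// (lt_trans jk).
  by rewrite fgE.
- subst k; exists i; split=> [j ji|]; first by rewrite fgE// ghE.
  exact: lt_trans gh.
Qed.

Fact lexfun_lt_total f g : f != g -> lexfun_lt f g || lexfun_lt g f.
Proof.
move=> fg; pose D : {pred I} := [pred i | f i != g i].
have [i [[Di minD] _]] : exists! i, minimum_of <=%O D i.
  apply: le_well_order; apply: contrapT => D0.
  move/eqP: fg; apply; apply: funext => i; apply/eqP; apply: contrapT.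
  by move=> /negP fgi; apply: D0; exists i.
have fgE j : j < i -> f j = g j.
  move=> ji; apply/eqP; apply: contrapT => /negP fgj.
  by have := minD j fgj; rewrite leNgt ji.
move: Di; rewrite inE neq_lt => /orP[lt_fg|lt_gf]; apply/orP.
- by left; apply/asboolP; exists i.
- by right; apply/asboolP; exists i; split=> // j /fgE.
Qed.

HB.instance Definition _ :=
  @Order.LtOrder.Build (Order.lexi_display d d') (lexfun I T)
    lexfun_le lexfun_lt _ _
    (fun _ _ => erefl) (fun _ _ => erefl) (fun _ _ => erefl)
    lexfun_lt_irr lexfun_lt_trans lexfun_lt_total.

End Lexicographic.

(* R \ Q as a suborder of R *)
Definition irrationals (R : realType) : Type := {x : R | x \in @irrational R}.

HB.instance Definition _ (R : realType) :=
  SubChoice.copy (irrationals R) {x : R | x \in @irrational R}.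
HB.instance Definition _ (R : realType) :=
  [SubChoice_isSubOrder of irrationals R by <: with ring_display].

(* Main.v *)
(** Pulling back along an epimorphism L -> Q maps gaps of Q injectively to gaps
    of L.  The cuts of Q at the sums of the series b_k / 3^k are pairwise
    distinct for b in 2^N, and only countably many of them are cuts at a
    rational, so Q has 2^N gaps and hence so does L.  On the other hand R and
    2^alpha are complete, the gaps of R \ Q are the cuts at the rationals, and
    those of Z^N are the cuts just above a cone given by a finite prefix.

    Q embeds into R \ Q by a translation, and into a lexicographic power over a
    countable index set by sending q to the indicator of {i | v i < q}, with v
    enumerating Q: this is monotone even for the pointwise order. *)
Require Import Defs.
From mathcomp Require Import all_boot all_order all_algebra.
From mathcomp Require Import boolp classical_sets functions cardinality wochoice.
From mathcomp Require Import reals zify lra.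

Set Implicit Arguments.
Unset Strict Implicit.
Unset Printing Implicit Defensive.

Import Order.TTheory GRing.Theory Num.Theory.
Local Open Scope order_scope.
Local Open Scope card_scope.
Local Open Scope classical_set_scope.

(** * Cardinality of the set of binary sequences *)

Lemma uncountable_seq_bool : ~ countable [set: nat -> bool].
Proof.
move=> /countable_injP[f finj].
(* Cantor's diagonal: [b] is false at [n] exactly when [n] codes a sequence that is true at [n], so
   [b] contradicts itself at its own code. *)
pose b n := ~~ `[< exists c, f c = n /\ c n >].
have : b (f b) = ~~ b (f b).
  rewrite {1}/b; congr negb; apply/asboolP/idP => [[c [fcb]]|bb].
    by rewrite (finj c b) ?inE.
  by exists b.
by case: (b (f b)).
Qed.

Lemma countable_card_lt {T : Type} (A : set T) :
  countable A -> card_lt A [set: nat -> bool].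
Proof.
move=> cA; split; last by move=> /sub_countable /(_ cA) /uncountable_seq_bool.
apply: card_le_trans cA _; apply/pcard_injP.
exists (fun n k => k == n) => n m _ _ /(congr1 (@^~ n)).
by rewrite eqxx => /esym/eqP.
Qed.

(* Split 2^N as 2^N x 2^N: a countable set misses some fibre. *)
Lemma inj_avoiding_countable {T : Type} (f : (nat -> bool) -> T) (C : set T) :
  injective f -> countable C ->
  exists2 g : (nat -> bool) -> T,
    injective g & forall b, range f (g b) /\ ~ C (g b).
Proof.
move=> finj cC.
pose mix (b c : nat -> bool) n := if odd n then b n./2 else c n./2.
have mix_inj b c b' c' : mix b c = mix b' c' -> b = b' /\ c = c'.
  move=> e; split; apply: funext => n.
  - by have := congr1 (@^~ n.*2.+1) e; rewrite /mix /= odd_double uphalf_double.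
  - by have := congr1 (@^~ n.*2) e; rewrite /mix /= odd_double doubleK.
pose D := [set b | exists c, C (f (mix b c))].
have cD : countable D.
  case/countable_injP: cC => h hinj.
  (* Choosing a point of [C] in each fibre over [D] injects [D] into [C], because the fibres are
     disjoint. *)
  have /choice[w wP] b : exists c, D b -> C (f (mix b c)).
    by have [[c Cc]|nD] := pselect (D b); [exists c | exists b => /nD].
  apply/countable_injP; exists (fun b => h (f (mix b (w b)))) => b b'.
  rewrite !inE => /wP Cb /wP Cb' /hinj.
  by rewrite !inE => /(_ Cb Cb') /finj /mix_inj[].
have [b nDb] : exists b, ~ D b.
  apply: contrapT => /forallNP DT; apply: uncountable_seq_bool.
  by apply: sub_countable cD; apply: subset_card_le => b _; apply: contrapT.
exists (fun c => f (mix b c)) => [c c' /finj /mix_inj[] //|c].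
by split; [exists (mix b c) | move=> Cc; apply: nDb; exists c].
Qed.

(** By surjectivity, a maximum of the preimage would map to a maximum of [A], and a minimum of its
    complement to a minimum of the complement of [A]. *)
Lemma preimage_gap {d d'} {M : orderType d} {L : orderType d'} (f : M -> L)
  (A : set L) : epimorphism f -> is_gap A -> is_gap (f @^-1` A).
Proof.
move=> [fle fsurj] [Ainit [a Aa] Amax [b nAb] Amin].
have fs y : exists x, f x = y by have [x _ fx] := fsurj y I; exists x.
split.
- by move=> x y /fle xy; exact: Ainit.
- by have [x fx] := fs a; exists x; rewrite /preimage /= fx.
- rewrite -subset0 => x [/= Ax ubx].
  suff: (A `&` ubound A) (f x) by rewrite Amax.
  split=> [//|y Ay].
  by have [z fz] := fs y; rewrite -fz; apply/fle/ubx; rewrite /= fz.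
- by have [x fx] := fs b; exists x; rewrite /preimage /= fx.
- rewrite -subset0 => x [/= Ax lbx].
  suff: (~` A `&` lbound (~` A)) (f x) by rewrite Amin.
  split=> [//|y Ay].
  by have [z fz] := fs y; rewrite -fz; apply/fle/lbx; rewrite /= fz.
Qed.

(** * Gaps of the rationals from ternary series *)

Section RationalGaps.
Local Open Scope ring_scope.
Implicit Types b c : nat -> bool.

Definition ternary_sum b n : rat := \sum_(k < n) (b k)%:R / 3 ^+ k.

Lemma ternary_sumS b n :
  ternary_sum b n.+1 = ternary_sum b n + (b n)%:R / 3 ^+ n.
Proof. by rewrite /ternary_sum big_ord_recr. Qed.

Lemma exp3_gt0 n : 0 < (3 ^+ n)^-1 :> rat.
Proof. by rewrite invr_gt0 exprn_gt0. Qed.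

Lemma exp3S n : (3 ^+ n.+1)^-1 = (3 ^+ n)^-1 / 3 :> rat.
Proof. by rewrite exprS invfM mulrC. Qed.

Lemma ternary_sum_le b n m : (n <= m)%N -> ternary_sum b n <= ternary_sum b m.
Proof.
elim: m => [|m IH]; first by rewrite leqn0 => /eqP->.
rewrite leq_eqVlt => /orP[/eqP->//|/IH/le_trans]; apply.
have := exp3_gt0 m; rewrite ternary_sumS; case: (b m) => /=; lra.
Qed.

(* 3^-n * 3/2 is the sum of the tail of the series when all b_k are 1. *)
Lemma ternary_sum_tail b n m : (n <= m)%N ->
  ternary_sum b m + (3 ^+ m)^-1 * (3 / 2)
    <= ternary_sum b n + (3 ^+ n)^-1 * (3 / 2).
Proof.
elim: m => [|m IH]; first by rewrite leqn0 => /eqP->.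
rewrite leq_eqVlt => /orP[/eqP->//|/IH]; apply: le_trans.
have := exp3_gt0 m; rewrite ternary_sumS exp3S; case: (b m) => /=; lra.
Qed.

Definition ternary_cut b : set rat := [set q | exists n, q < ternary_sum b n].

(** At the first difference [k] the sum for [c] gains [3^-k], whereas all later terms for [b] add at
    most [3^-k / 2]; the factor [3 / 4] separates the two. *)
Lemma ternary_cut_neq b c k : (forall j, (j < k)%N -> b j = c j) ->
  b k = false -> c k = true -> ternary_cut b <> ternary_cut c.
Proof.
move=> bc bk ck bcE.
have sE : ternary_sum b k = ternary_sum c k.
  by apply: eq_bigr => i _; rewrite bc.
have := exp3_gt0 k => k0.
have [n] : ternary_cut b (ternary_sum b k + (3 ^+ k)^-1 * (3 / 4)).
  rewrite bcE; exists k.+1; rewrite ternary_sumS ck sE /=; lra.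
have [nk|kn] := leqP n k.
  by have := ternary_sum_le b nk; lra.
have := ternary_sum_tail b kn; rewrite ternary_sumS bk exp3S.
have := exp3_gt0 n => /=; lra.
Qed.

Lemma ternary_cut_inj : injective ternary_cut.
Proof.
move=> b c bcE; apply: contrapT => bc.
have : exists k, b k != c k.
  apply: contrapT => /forallNP nex; apply: bc; apply: funext => k.
  by apply/eqP; rewrite -[_ == _]negbK; apply/negP/nex.
move=> /ex_minnP[k bck kmin].
have bcj j : (j < k)%N -> b j = c j.
  by move=> jk; apply/eqP; apply: contraTT jk => /kmin; rewrite leqNgt.
case bk: (b k) bck; case ck: (c k) => // _.
  by apply: (@ternary_cut_neq c b k) => // j jk; rewrite bcj.
exact: (@ternary_cut_neq b c k).
Qed.

(** A union of open rays has no maximum, by taking midpoints; a minimum [q] of the complement would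
    make the cut the ray below [q]. *)
Lemma ternary_cut_gap b :
  (forall q, ternary_cut b <> [set x | x < q]) -> is_gap (ternary_cut b).
Proof.
move=> ncut; have init : initial_segment (ternary_cut b).
  by move=> x y xy [n yn]; exists n; apply: le_lt_trans yn.
split=> //.
- by exists (-1), 0%N; rewrite /ternary_sum big_ord0.
- rewrite -subset0 => x [[n xn] ubx].
  have := ubx ((x + ternary_sum b n) / 2).
  rewrite leNgt midf_lt// => /(_ _)/negP.
  by apply=> //; exists n; rewrite midf_lt.
(* The tail bound from index 0 keeps every partial sum below [3 / 2]. *)
- exists 2 => -[n]; have := @ternary_sum_tail b 0 n isT.
  rewrite /ternary_sum big_ord0 expr0; have := exp3_gt0 n; lra.
- rewrite -subset0 => q [nq lbq]; apply: (ncut q); apply/seteqP; split=> x /=.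
    by move=> bx; rewrite ltNge; apply: contra_notN nq => qx; apply: init bx.
  by move=> xq; apply: contrapT => /lbq; rewrite leNgt xq.
Qed.

Lemma rat_gaps_inj :
  exists2 g : (nat -> bool) -> set rat, injective g & forall b, is_gap (g b).
Proof.
have cC : countable (range (fun q : rat => [set x | x < q])).
  by apply: card_le_trans (card_image_le _ _) _; exact: countableP.
have [g ginj gP] := inj_avoiding_countable ternary_cut_inj cC.
exists g => // b; have [[c _ <-] nC] := gP b.
by apply: ternary_cut_gap => q qE; apply: nC; exists q.
Qed.

End RationalGaps.

Lemma card_gaps_epi_rat {d} {L : orderType d} :
  le_s rat L -> [set: nat -> bool] #<= gaps L.
Proof.
move=> [f fepi]; have [g ginj gP] := rat_gaps_inj.
have fg_inj : injective (fun b => f @^-1` (g b)).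
  move=> b c bcE; apply: ginj; apply/seteqP; split=> q.
  - have [x _ <-] := fepi.2 q I.
    by have := congr1 (@^~ x) bcE; rewrite /preimage /= => ->.
  - have [x _ <-] := fepi.2 q I.
    by have := congr1 (@^~ x) bcE; rewrite /preimage /= => ->.
have fg_in : (fun b => f @^-1` (g b)) @` [set: _] `<=` gaps L.
  by move=> _ [b _ <-]; exact: preimage_gap.
apply: card_le_trans (subset_card_le fg_in).
by rewrite (card_le_eql (card_esym (inj_card_eq (in2W fg_inj)))).
Qed.

Lemma card_lt_gaps_not_le_s {d} {L : orderType d} :
  card_lt (gaps L) [set: nat -> bool] -> ~ le_s rat L.
Proof. by move=> [_ ng] /card_gaps_epi_rat. Qed.

Lemma countable_gaps_witness {d} {M : orderType d} :
  embeds rat M -> countable (gaps M) ->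
  witnesses_not_strongly_surjective rat M /\ ~ strongly_surjective M.
Proof.
move=> ratM /countable_card_lt /card_lt_gaps_not_le_s nM.
by split=> // /(_ _ rat) sM; apply/nM/sM => //; exists 0%R.
Qed.

(** A supremum is the maximum of [A] if it lies in [A], and otherwise the minimum of the
    complement. *)
Lemma lub_not_gap {d} {K : orderType d} (A : set K) (m : K) :
  ubound A m -> lbound (ubound A) m -> ~ is_gap A.
Proof.
move=> ubm lbm [Ainit _ Amax _ Amin].
have [Am|nAm] := pselect (A m).
  by suff : (A `&` ubound A) m by rewrite Amax.
suff : (~` A `&` lbound (~` A)) m by rewrite Amin.
split=> // y nAy; apply: lbm => x Ax; rewrite leNgt.
by apply: contra_notN nAy => /ltW yx; exact: Ainit Ax.
Qed.

(** * The reals and the irrationals *)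

Section RealOrders.
Variable R : realType.
Local Open Scope ring_scope.

Lemma gap_has_sup (A : set R) : A !=set0 -> ~` A !=set0 ->
  initial_segment A -> has_sup A.
Proof.
move=> A0 [y nAy] Ainit; split=> //; exists y => x Ax; rewrite leNgt.
by apply: contra_notN nAy => /ltW yx; exact: Ainit Ax.
Qed.

Lemma gaps_real : gaps R = set0.
Proof.
rewrite -subset0 => A gA; have [Ainit A0 _ nA0 _] := gA.
have [_ ubA] := gap_has_sup A0 nA0 Ainit.
by case: (lub_not_gap (m := sup A) _ _ gA) => [x|y];
  [exact: ub_le_sup|exact: ge_sup].
Qed.

Lemma ratr_mono : embedding (ratr : rat -> R).
Proof. by split=> [x y|]; [rewrite ler_rat | exact: fmorph_inj]. Qed.

(* Otherwise the inverse of [ratr] maps R onto Q, but R has no gaps. *)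
Lemma irrational_exists : @irrational R !=set0.
Proof.
apply: contrapT => /forallNP nirr.
have /choice[f fP] (x : R) : exists q : rat, ratr q = x.
  by have [q _ <-] := contrapT (nirr x); exists q.
apply: (@card_lt_gaps_not_le_s _ R).
  by rewrite gaps_real; exact: countable_card_lt.
exists f; split=> [x y|q _]; first by rewrite -(ler_rat R) !fP.
by exists (ratr q) => //; apply: ratr_mono.2; rewrite fP.
Qed.

Lemma rat_embeds_irrationals : embeds rat (irrationals R).
Proof.
have [x irrx] := irrational_exists.
have irrD q : ratr q + x \in @irrational R.
  rewrite inE => -[p _ pE]; apply: irrx; exists (p - q) => //.
  by rewrite rmorphB/= pE addrC addKr.
exists (fun q => Sub (ratr q + x) (irrD q) : irrationals R).
split=> [p q pq|p q /(congr1 val)].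
  by rewrite -Order.le_val !SubK lerD2r ler_rat.
by rewrite !SubK => /addIr /ratr_mono.2.
Qed.

(** An irrational real supremum of a gap would also be its supremum among the irrationals. So the
    supremum is some rational [q], and the gap is the cut at [q]. *)
Lemma countable_gaps_irrationals : countable (gaps (irrationals R)).
Proof.
pose cut (q : rat) := [set x : irrationals R | val x < ratr q].
have cC : countable (range cut).
  by apply: card_le_trans (card_image_le _ _) _; exact: countableP.
apply: sub_countable cC; apply: subset_card_le => A gA.
have [Ainit [a Aa] _ [b nAb] _] := gA.
pose B := val @` A.
have Bub y : ~ A y -> ubound B (val y).
  move=> nAy _ [x Ax <-]; rewrite leNgt; apply: contra_notN nAy => yx.
  by apply: Ainit Ax; apply: ltW.
have B0 : B !=set0 by exists (val a), a.
have Bub0 : has_ubound B by exists (val b); exact: Bub.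
have [irrs|/contrapT[q _ qs]] := pselect (irrational (sup B)).
  pose s : irrationals R := Sub (sup B) (mem_set irrs).
  case: (@lub_not_gap _ _ A s _ _ gA) => [x Ax|y uby].
    by apply: (ub_le_sup Bub0); exists x.
  by apply: ge_sup => // _ [x Ax <-]; apply: uby.
exists q => //; apply/seteqP; split=> x; rewrite /cut /= qs.
  by move=> xs; apply: contrapT => /Bub /(ge_sup B0); rewrite leNgt xs.
move=> Ax; rewrite lt_neqAle ub_le_sup// ?andbT; last by exists x.
apply/eqP => xs; have := valP x; rewrite inE; apply; exists q => //.
by rewrite qs -xs.
Qed.

End RealOrders.

(** * Recursion and suprema in lexicographic powers *)

Section LexicographicOrders.
Context {d d' : Order.disp_t} {I : wellOrderType d} {T : orderType d'}.
Implicit Types (i j : I) (f g m : lexfun I T) (A : set (lexfun I T)).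

Lemma well_order_min (P : set I) : P !=set0 ->
  exists2 i, P i & forall j, j < i -> ~ P j.
Proof.
move=> [k Pk]; pose D : {pred I} := fun i => `[< P i >].
have [|i [[Di minD] _]] := @le_well_order _ I D.
  by exists k; apply/asboolP.
exists i; first exact/asboolP.
by move=> j ji Pj; have := minD j (asboolT Pj); rewrite leNgt ji.
Qed.

Lemma well_order_wf : well_founded (fun i j => i < j).
Proof.
move=> i; apply: contrapT => nacc.
have [|k nk kmin] := @well_order_min [set i | ~ Acc (fun i j => i < j) i].
  by exists i.
by apply: nk; split=> j /kmin /contrapT.
Qed.

Definition agree_below i f g := forall j, j < i -> f j = g j.

(** Serves to build suprema greedily: the value at [i] is chosen from the members of [A] that agree
    with all the values chosen before. *)
Lemma lexfun_rec A (step : I -> set (lexfun I T) -> T) :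
  exists m, forall i, m i = step i [set f | A f /\ agree_below i f m].
Proof.
pose F i (r : forall j, j < i -> T) :=
  step i [set f | A f /\ forall j (ji : j < i), f j = r j ji].
exists (Fix well_order_wf (fun=> T) F) => i.
rewrite {1}Fix_eq//= => k r s rs; congr step; apply/seteqP.
by split=> f [Af fE]; split=> // j jk; rewrite fE rs.
Qed.

Lemma lexfun_ltP f g :
  reflect (exists2 i, agree_below i f g & f i < g i) (f < g).
Proof. by apply: (iffP (asboolP _)) => [[i []]|[i]]; exists i. Qed.

Lemma lexfun_le_at i f g : f <= g -> agree_below i f g -> f i <= g i.
Proof.
move=> fg agr; rewrite leNgt; apply/negP => gf.
have : g < f by apply/lexfun_ltP; exists i => // j /agr.
by rewrite ltNge fg.
Qed.

(** Any strict comparison with [m] is decided at a first difference [i], so it suffices to control,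
    at each [i], the members of [A] that agree with [m] below [i]. *)
Lemma lexfun_lub A m :
  (forall i f, A f -> agree_below i f m -> f i <= m i) ->
  (forall i t, t < m i -> exists f, [/\ A f, agree_below i f m & t < f i]) ->
  ubound A m /\ lbound (ubound A) m.
Proof.
move=> mub mlub; split=> [f Af|g ubg]; rewrite leNgt; apply/negP.
  move=> /lexfun_ltP[i mf]; apply/negP; rewrite -leNgt; apply: mub => // j ji.
  by rewrite mf.
move=> /lexfun_ltP[i gm /mlub[f [Af fm]]]; apply/negP; rewrite -leNgt.
by apply: lexfun_le_at; [exact: ubg | move=> j ji; rewrite fm// gm].
Qed.

Lemma rat_embeds_lexfun (v : I -> rat) (lo hi : T) : lo < hi ->
  set_surj [set: I] [set: rat] v -> embeds rat (lexfun I T).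
Proof.
move=> lohi vsurj.
pose F (q : rat) : lexfun I T := fun i => if v i < q then hi else lo.
have Flt p q : p < q -> F p < F q.
  (* [F p] and [F q] first differ at the least [i] with [v i] in [[p, q)], which exists since [v]
     attains [p]. *)
  move=> pq; have [|i] := @well_order_min [set i | p <= v i < q].
    by have [i _ vi] := vsurj p Logic.I; exists i; rewrite /= vi lexx.
  move=> /andP[pi iq] imin; apply/lexfun_ltP; exists i => [j ji|]; last first.
    by rewrite /F iq (ltNge (v i)) pi.
  have /negP := imin j ji; rewrite /F negb_and -ltNge -leNgt.
  move=> /orP[jp|qj]; first by rewrite jp (lt_trans jp).
  by rewrite !(ltNge (v j)) qj (le_trans (ltW pq)).
exists F; split=> [p q|p q FE].
  by rewrite le_eqVlt => /orP[/eqP->//|/Flt/ltW].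
by have [/Flt|/Flt|//] := ltgtP p q; rewrite FE ltxx.
Qed.

End LexicographicOrders.

(** * Gaps of binary and of integer sequences *)

Lemma gaps_lexfun_bool {d} {I : wellOrderType d} :
  gaps (lexfun I bool) = set0.
Proof.
rewrite -subset0 => A gA.
(* If no member of [A] agrees with [m] below [i], then [m i] is false and nothing lies below it, as
   [lexfun_lub] requires. *)
have [m mP] := lexfun_rec A (fun i B =>
  `[< exists2 f : lexfun I bool, B f & f i >]).
have [mub mlub] : ubound A m /\ lbound (ubound A) m;
  last exact: lub_not_gap mub mlub gA.
apply: lexfun_lub => [i f Af fm|i t].
  have : f i -> m i by move=> fi; rewrite mP; apply/asboolP; exists f.
  by case: (f i) (m i) => -[] // /(_ isT).
move=> tm; have [nt] : t = false /\ m i by case: t (m i) tm => -[].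
rewrite mP => /asboolP[f [Af fm] fi]; exists f; split=> //.
by rewrite nt; case: (f i) fi.
Qed.

(** The maximum is the element at the least natural distance below the bound [u]. *)
Lemma int_set_max (B : set int) : B !=set0 -> has_ubound B ->
  exists2 k, B k & ubound B k.
Proof.
move=> [b0 Bb0] [u ubu].
have distK b : B b -> B (u - `|u - b|%N%:Z)%R.
  by move=> Bb; rewrite gez0_abs ?subKr// subr_ge0; exact: ubu.
have /ex_minnP[n] : exists n, `[< B (u - n%:Z)%R >].
  by exists `|u - b0|%N; apply/asboolP/distK.
move=> /asboolP Bn nmin; exists (u - n%:Z)%R => // b Bb.
have := nmin _ (asboolT (distK b Bb)); have := ubu b Bb; lia.
Qed.

(* If a gap is the down-closure of no cone of sequences with a given prefix,
   then the maximal prefixes of its members glue to its least upper bound. *)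
Lemma countable_gaps_lexfun_int : countable (gaps (lexfun nat int)).
Proof.
pose cut (s : seq int) :=
  [set f : lexfun nat int |
    exists2 g : lexfun nat int, mkseq g (size s) = s & f <= g].
have cC : countable (range cut).
  by apply: card_le_trans (card_image_le _ _) _; exact: countableP.
apply: sub_countable cC; apply: subset_card_le => A gA.
apply: contrapT => ncut; have [Ainit A0 _ _ _] := gA.
(* [m i] is the largest value at [i] among the members agreeing so far; [step] and [main] show that
   it exists, so the default [0] is never taken. *)
have [m mP] := lexfun_rec A (fun i B =>
  xget 0%R [set k | (exists2 f : lexfun nat int, B f & f i = k) /\
                    forall f, B f -> f i <= k]).
have agreeE n (f : lexfun nat int) :
    mkseq f n = mkseq m n <-> agree_below (n : nat) f m.
  split=> [e j jn|e]; last first.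
    by apply/eq_in_map => j; rewrite mem_iota => /e.
  by have := congr1 (nth 0%R ^~ j) e; rewrite !nth_mkseq.
have step n :
    (forall i, (i < n)%N ->
      forall f, A f -> agree_below i f m -> f i <= m i) ->
    (exists2 f, A f & agree_below n f m) ->
    (exists f, [/\ A f, agree_below n f m & f n = m n]) /\
    (forall f, A f -> agree_below n f m -> f n <= m n).
  move=> ub [f Af fm].
  (* A member that leaves the prefix of [m] before [n] can only drop below [m], by [ub]. *)
  have Acut : A `<=` cut (mkseq m n).
    move=> h Ah; rewrite /cut /=; rewrite size_mkseq.
    have [hm|nhm] := pselect (agree_below n h m).
      by exists h => //; exact/agreeE.
    exists m => //; rewrite leNgt; apply/negP => /lexfun_ltP[i mh mhi].
    have [ni|/= ni] := ltP i n.
      have := ub i ni h Ah (fun j ji => esym (mh j ji)).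
      by rewrite leNgt mhi.
    by apply: nhm => j jn; rewrite mh// (lt_le_trans jn).
  (* The sequence [g] bounds every member [f'] that shares its prefix: [g < f'] would put [h] into
     [A]. Hence [g n] bounds the values at [n]. *)
  have [h [g gm hg] nAh] : exists2 h, cut (mkseq m n) h & ~ A h.
    apply: contrapT => nex; apply: ncut; exists (mkseq m n) => //.
    apply/seteqP; split=> // h ch; apply: contrapT => nAh.
    by apply: nex; exists h.
  rewrite size_mkseq in gm; move/agreeE: gm => gm.
  have [||k [f0 [Af0 f0m] f0k] kub] :=
      @int_set_max [set k | exists2 f, A f /\ agree_below n f m & f n = k].
  - by exists (f n), f.
  - exists (g n) => _ [f' [Af' f'm] <-]; apply: lexfun_le_at.
      rewrite leNgt; apply: contra_notN nAh => /ltW gf'.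
      exact: Ainit (le_trans hg gf') Af'.
    by move=> j jn; rewrite f'm// gm.
  have : [set k | (exists2 f, A f /\ agree_below n f m & f n = k) /\
                  forall f, A f /\ agree_below n f m -> f n <= k] (m n).
    rewrite mP; apply: xgetPex; exists k; split; first by exists f0.
    by move=> f' f'P; apply: kub; exists f'.
  move=> [[f1 [Af1 f1m] f1n] mub]; split; first by exists f1.
  by move=> f' Af' f'm; exact: mub.
have main n : (exists2 f, A f & agree_below n f m) /\
    forall i, (i < n)%N -> forall f, A f -> agree_below i f m -> f i <= m i.
  elim: n => [|n [ex ub]]; first by split=> //; have [f Af] := A0; exists f.
  have [[f [Af fm fn]] ubn] := step n ub ex; split.
    exists f => // j; rewrite ltEnat /= ltnS leq_eqVlt => /orP[/eqP->//|].
    exact: fm.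
  by move=> i; rewrite ltnS leq_eqVlt => /orP[/eqP->//|]; exact: ub.
have [mub mlub] : ubound A m /\ lbound (ubound A) m;
  last exact: lub_not_gap mub mlub gA.
(* The bound in [main n] covers only indices below [n], hence [i.+1]. *)
apply: lexfun_lub => [i f|i t tm]; first exact: (main i.+1).2.
have [ex ub] := main i; have [[f [Af fm fi]] _] := step i ub ex.
by exists f; rewrite fi.
Qed.

Theorem corollary5p4 :
  (forall (d : Order.disp_t) (L : orderType d),
     ([set: L] !=set0)%classic ->
     card_lt (gaps L) [set: nat -> bool]%classic ->
     ~ le_s rat L)
  /\
  (forall R : realType,
     witnesses_not_strongly_surjective rat R /\ ~ strongly_surjective R)
  /\
  (forall R : realType,
     witnesses_not_strongly_surjective rat (irrationals R) /\
     ~ strongly_surjective (irrationals R))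
  /\
  (witnesses_not_strongly_surjective rat (lexfun nat int) /\
     ~ strongly_surjective (lexfun nat int))
  /\
  (forall (d : Order.disp_t) (alpha : wellOrderType d),
     countable [set: alpha]%classic -> ord_le nat alpha ->
     witnesses_not_strongly_surjective rat (lexfun alpha bool) /\
     ~ strongly_surjective (lexfun alpha bool)).
Proof.
have /pcard_surjP[v vsurj] : [set: rat] #<= [set: nat] by exact: countableP.
split; first by move=> d L _; exact: card_lt_gaps_not_le_s.
split.
  move=> R; apply: countable_gaps_witness; last by rewrite gaps_real.
  by exists ratr; exact: ratr_mono.
split.
  move=> R; apply: countable_gaps_witness; first exact: rat_embeds_irrationals.
  exact: countable_gaps_irrationals.
split.
  apply: countable_gaps_witness; last exact: countable_gaps_lexfun_int.
  exact: (@rat_embeds_lexfun _ _ _ _ v 0%R 1%R).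
move=> d alpha _ [e [[_ einj] _]].
apply: countable_gaps_witness; last by rewrite gaps_lexfun_bool.
(* The copy of [nat] inside [alpha] provides enough indices to enumerate the rationals. *)
have /pcard_surjP[w wsurj] : [set: rat] #<= [set: alpha].
  have : [set: nat] #<= [set: alpha].
    apply: card_le_trans (subset_card_le (@subsetT _ (range e))).
    by rewrite (card_le_eqr (inj_card_eq (in2W einj))).
  by apply: card_le_trans; exact: countableP.
exact: (@rat_embeds_lexfun _ _ _ _ w false true).
Qed.
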